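(* Let $n\ge 3$, $B\ge 1$, $G\ge B$, and let the labels $y_1,\dots,y_n\in[-G,G]$ be generated by an (possibly adaptive) adversary. Let $x_1,\dots,x_n$ be the predictions of FLH-OGD (defined in the context) with learning rate $\zeta=1/(2(G+B)^2)$. Then there exist a constant $c>0$ depending only on $G,B$ and an absolute constant $p\ge 0$ such that for every $C_n\ge 0$ and every comparator sequence $(w_1,\dots,w_n)\in\mathcal{TV}^B(C_n)$, $$\sum_{t=1}^n (y_t-x_t)^2-(y_t-w_t)^2\;\le\; c\,(\log n)^p\,\max\{n^{1/3}C_n^{2/3},\,1\}.$$ (The paper writes this as $\tilde O(n^{1/3}C_n^{2/3}\vee 1)$, with $\tilde O$ hiding logarithmic factors of $n,G,B$.) The algorithm does not need $C_n$ as input.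
   Context: Squared loss game: for $t=1,\dots,n$ the learner predicts $x_t\in[-B,B]$, then the adversary reveals $y_t\in[-G,G]$ and the learner suffers $(y_t-x_t)^2$. For integers $a\le b$ write $[a,b]=\{a,\dots,b\}$ and $[n]=[1,n]$. $\mathcal{TV}^B(C_n)=\{w_{1:n}: \sum_{t=2}^n|w_t-w_{t-1}|\le C_n,\ |w_t|\le B\ \forall t\}$. FLH-OGD: For each $j\in[n]$ a base learner $E^j$ is started at time $j$; it runs projected online gradient descent on $[-B,B]$ on the losses $x\mapsto (y_t-x)^2$, $t\ge j$: its first prediction $x^{(j)}_j$ is a fixed point of $[-B,B]$, and $x^{(j)}_{t+1}=\Pi\big(x^{(j)}_t-\tfrac{1}{2\tau}\cdot 2(x^{(j)}_t-y_t)\big)$ with $\tau=t-j+1$, where $\Pi$ is the projection onto $[-B,B]$. The FLH meta-algorithm with learning rate $\zeta$ keeps a probability vector $v_t=(v_t^{(1)},\dots,v_t^{(t)})$, $v_1=(1)$; at time $t$ it predicts $x_t=\sum_{j\le t}v_t^{(j)}x^{(j)}_t$; after $y_t$ is revealed it sets $\hat v^{(i)}_{t+1}=v_t^{(i)}e^{-\zeta(y_t-x_t^{(i)})^2}/\sum_{j\le t}v_t^{(j)}e^{-\zeta(y_t-x_t^{(j)})^2}$ for $i\le t$, then $v^{(t+1)}_{t+1}=1/(t+1)$ and $v^{(i)}_{t+1}=(1-\tfrac1{t+1})\hat v^{(i)}_{t+1}$ for $i\le t$. FLH-OGD is FLH with learning rate $\zeta=1/(2(G+B)^2)$ and these OGD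 base learners. *)

(* Defs.v *)
From Stdlib Require Import Reals Lra Arith.
Open Scope R_scope.

Fixpoint sum_to (f : nat -> R) (n : nat) : R :=
  match n with
  | O => 0
  | S m => sum_to f m + f (S m)
  end.

(* real power x^a for x >= 0 (with the convention 0^a = 0, used for a > 0) *)
Definition rpow (x a : R) : R := if Rle_dec x 0 then 0 else Rpower x a.

Definition proj (B z : R) : R := Rmax (- B) (Rmin B z).

(* OGD base learner E^j started at time j with initial point x0:
   ogd_k B x0 y j k = prediction x^{(j)}_{j+k}. Step at time t = j+k uses tau = k+1. *)
Fixpoint ogd_k (B x0 : R) (y : nat -> R) (j k : nat) : R :=
  match k with
  | O => x0
  | S k' =>
      let x := ogd_k B x0 y j k' in
      let tau := INR (S k') in
      proj B (x - / (2 * tau) * (2 * (x - y (j + k')%nat)))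
  end.

(* prediction x^{(j)}_t of base learner j at time t (meaningful for t >= j) *)
Definition base_pred (B x0 : R) (y : nat -> R) (j t : nat) : R :=
  ogd_k B x0 y j (t - j).

Definition zeta (B G : R) : R := 1 / (2 * (G + B) ^ 2).

Definition flh_step (B G x0 : R) (y : nat -> R) (t : nat) (vt : nat -> R)
  : nat -> R :=
  let e := fun i => exp (- zeta B G * (y t - base_pred B x0 y i t) ^ 2) in
  let Z := sum_to (fun j => vt j * e j) t in
  fun i =>
    if Nat.eqb i (S t) then / INR (S t)
    else if andb (1 <=? i)%nat (i <=? t)%nat then
      (1 - / INR (S t)) * (vt i * e i / Z)
    else 0.

(* flh_vk k = v_{k+1} *)
Fixpoint flh_vk (B G x0 : R) (y : nat -> R) (k : nat) : nat -> R :=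
  match k with
  | O => fun i => if Nat.eqb i 1 then 1 else 0
  | S k' => flh_step B G x0 y (S k') (flh_vk B G x0 y k')
  end.

(* weight vector v_t, t >= 1 *)
Definition flh_v (B G x0 : R) (y : nat -> R) (t : nat) : nat -> R :=
  flh_vk B G x0 y (t - 1).

Definition flh_ogd_pred (B G x0 : R) (y : nat -> R) (t : nat) : R :=
  sum_to (fun j => flh_v B G x0 y t j * base_pred B x0 y j t) t.

Definition in_TV (B C : R) (n : nat) (w : nat -> R) : Prop :=
  sum_to (fun t => if (2 <=? t)%nat then Rabs (w t - w (t - 1)%nat) else 0) n <= C
  /\ (forall t : nat, (1 <= t <= n)%nat -> Rabs (w t) <= B).

(* Main.v *)
(** FLH-OGD has regret at most [kappa = O(ln n)] on every interval against every
    fixed point of [[-B, B]], hence regret at most [kappa * (1 + J)] against every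
    sequence with [J] jumps. An arbitrary comparator [w] is reduced to sequences
    with few jumps by randomized rounding to a grid of width [d] with one random
    shift [U] shared by all times: [u_t = -B + d * floor ((w_t + B) / d + U)].
    The rounding is unbiased, so the cross term of [(y_t - u_t)^2 - (y_t - w_t)^2]
    has mean zero and only the variance, at most [d^2], is paid at each time; the
    expected number of jumps is at most [TV(w) / d]. The resulting bound
    [kappa * (1 + C / d) + n * d^2] is optimized at [d = (C / n)^(1/3)].
    The shift is taken uniform on [{0, 1/n, ..., (n-1)/n}], at the price of a bias
    of at most [d / n]. *)

Require Import Defs.
From Stdlib Require Import Reals Lra Lia ZArith Arith.
Open Scope R_scope.

(** * Finite sums *)

Lemma sum_to_S (f : nat -> R) (n : nat) : sum_to f (S n) = sum_to f n + f (S n).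
Proof. reflexivity. Qed.

(** Sums over a time interval [(a, b]] are written throughout as differences of two prefix sums. *)
Lemma sum_to_ext_range (f g : nat -> R) (a b : nat) :
  (a <= b)%nat -> (forall t, (a < t <= b)%nat -> f t = g t) ->
  sum_to f b - sum_to f a = sum_to g b - sum_to g a.
Proof.
  induction b as [|b IH]; intros Hab Hfg.
  - replace a with 0%nat by lia. lra.
  - destruct (Nat.eq_dec a (S b)) as [->|Hne]; [lra|].
    simpl. rewrite (Hfg (S b)) by lia.
    assert (H := IH ltac:(lia) ltac:(intros; apply Hfg; lia)). lra.
Qed.

Lemma sum_to_ext (f g : nat -> R) (n : nat) :
  (forall t, (1 <= t <= n)%nat -> f t = g t) -> sum_to f n = sum_to g n.
Proof.
  intros H. assert (E := sum_to_ext_range f g 0 n ltac:(lia) ltac:(intros; apply H; lia)).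
  simpl in E. lra.
Qed.

Lemma sum_to_le (f g : nat -> R) (n : nat) :
  (forall t, (1 <= t <= n)%nat -> f t <= g t) -> sum_to f n <= sum_to g n.
Proof.
  induction n as [|n IH]; intros H; simpl; [lra|].
  assert (H1 := IH ltac:(intros; apply H; lia)).
  assert (H2 := H (S n) ltac:(lia)). lra.
Qed.

Lemma sum_to_plus (f g : nat -> R) (n : nat) :
  sum_to (fun t => f t + g t) n = sum_to f n + sum_to g n.
Proof. induction n as [|n IH]; simpl; [|rewrite IH]; ring. Qed.

Lemma sum_to_minus (f g : nat -> R) (n : nat) :
  sum_to (fun t => f t - g t) n = sum_to f n - sum_to g n.
Proof. induction n as [|n IH]; simpl; [|rewrite IH]; ring. Qed.

Lemma sum_to_scal (c : R) (f : nat -> R) (n : nat) :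
  sum_to (fun t => c * f t) n = c * sum_to f n.
Proof. induction n as [|n IH]; simpl; [|rewrite IH]; ring. Qed.

Lemma sum_to_const (c : R) (n : nat) : sum_to (fun _ => c) n = INR n * c.
Proof.
  induction n as [|n IH]; [simpl; ring|].
  rewrite S_INR. simpl sum_to. rewrite IH. ring.
Qed.

Lemma sum_to_exchange (f : nat -> nat -> R) (m n : nat) :
  sum_to (fun i => sum_to (f i) n) m = sum_to (fun j => sum_to (fun i => f i j) m) n.
Proof.
  induction m as [|m IH]; simpl.
  - rewrite sum_to_const. ring.
  - rewrite IH, <- sum_to_plus. reflexivity.
Qed.

Lemma sum_to_nonneg (f : nat -> R) (n : nat) :
  (forall t, (1 <= t <= n)%nat -> 0 <= f t) -> 0 <= sum_to f n.
Proof.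
  intros H. replace 0 with (sum_to (fun _ => 0) n) by (rewrite sum_to_const; ring).
  apply sum_to_le; exact H.
Qed.

Lemma sum_to_ge_term (f : nat -> R) (n j : nat) :
  (forall t, (1 <= t <= n)%nat -> 0 <= f t) -> (1 <= j <= n)%nat -> f j <= sum_to f n.
Proof.
  induction n as [|n IH]; intros Hf Hj; [lia|]; simpl.
  destruct (Nat.eq_dec j (S n)) as [->|Hne].
  - assert (0 <= sum_to f n) by (apply sum_to_nonneg; intros; apply Hf; lia). lra.
  - assert (f j <= sum_to f n) by (apply IH; [intros; apply Hf|]; lia).
    assert (H' := Hf (S n) ltac:(lia)). lra.
Qed.

(** * Bounds on logarithms and harmonic sums *)

Lemma ln_monotone (a b : R) : 0 < a -> a <= b -> ln a <= ln b.
Proof.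
  intros Ha [Hab| ->]; [left; apply ln_increasing; assumption|right; reflexivity].
Qed.

Lemma ln_ge_1 (n : nat) : (3 <= n)%nat -> 1 <= ln (INR n).
Proof.
  intros Hn. rewrite <- (ln_exp 1). assert (H3 := exp_le_3).
  assert (H := le_INR _ _ Hn). replace (INR 3) with 3 in H by (simpl; ring).
  apply ln_monotone; [apply exp_pos|lra].
Qed.

Lemma sum_inv_le_ln (n : nat) : (1 <= n)%nat -> sum_to (fun t => / INR t) n <= 1 + ln (INR n).
Proof.
  induction n as [|n IH]; intros Hn; [lia|].
  destruct n as [|n]; [simpl; rewrite ln_1; lra|].
  set (m := S n) in *. assert (Hm : 0 < INR m) by (apply lt_0_INR; unfold m; lia).
  assert (IH' := IH ltac:(unfold m; lia)).
  change (sum_to (fun t => / INR t) m + / INR (S m) <= 1 + ln (INR (S m))).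
  rewrite S_INR.
  assert (H1 : 0 < INR m / (INR m + 1)) by (apply Rdiv_lt_0_compat; lra).
  (* The inequality 1 + z <= exp z at z = ln (m / (m+1)) gives 1 / (m+1) <= ln (m+1) - ln m. *)
  assert (H2 := exp_ineq1_le (ln (INR m / (INR m + 1)))).
  rewrite exp_ln in H2 by exact H1.
  unfold Rdiv in H2 at 1. rewrite ln_mult, ln_Rinv in H2; try lra; [|apply Rinv_0_lt_compat; lra].
  replace (INR m / (INR m + 1)) with (1 - / (INR m + 1)) in H2 by (field; lra). lra.
Qed.

(** * Regret of a base learner *)

Lemma proj_in (B z : R) : 0 <= B -> - B <= proj B z <= B.
Proof. intros HB. unfold proj, Rmax, Rmin. repeat destruct Rle_dec; lra. Qed.

Lemma proj_dist_sq (B z u : R) : - B <= u <= B -> (proj B z - u) ^ 2 <= (z - u) ^ 2.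
Proof.
  intros Hu. unfold proj, Rmax, Rmin. repeat destruct Rle_dec; nra.
Qed.

Lemma base_pred_in (B x0 : R) (y : nat -> R) (j t : nat) :
  0 <= B -> - B <= x0 <= B -> - B <= base_pred B x0 y j t <= B.
Proof.
  intros HB H0. unfold base_pred. destruct (t - j)%nat; [exact H0|]. apply proj_in; exact HB.
Qed.

(** The step 1 / (2 tau) matches the curvature of the square loss, so k (x_k - u)^2 is a potential
    that telescopes; keeping it on the right makes the bound inductive. Learner [S i] covers the
    times i+1, ..., i+k. *)
Lemma ogd_regret (B G x0 u : R) (y : nat -> R) (n i k : nat) :
  0 <= B -> - B <= x0 <= B -> - B <= u <= B ->
  (forall t, (1 <= t <= n)%nat -> - G <= y t <= G) -> (i + k <= n)%nat ->
  let f := fun t => (y t - base_pred B x0 y (S i) t) ^ 2 - (y t - u) ^ 2 in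
  sum_to f (i + k) - sum_to f i
  <= (G + B) ^ 2 * sum_to (fun t => / INR t) k - INR k * (ogd_k B x0 y (S i) k - u) ^ 2.
Proof.
  intros HB H0 Hu Hy Hk f. induction k as [|k IH].
  - rewrite Nat.add_0_r. simpl. lra.
  - specialize (IH ltac:(lia)).
    rewrite Nat.add_succ_r. cbn [sum_to].
    assert (Ef : f (S (i + k)) = (y (S (i + k)) - ogd_k B x0 y (S i) k) ^ 2 - (y (S (i + k)) - u) ^ 2).
    { unfold f, base_pred. replace (S (i + k) - S i)%nat with k by lia. reflexivity. }
    rewrite Ef. cbn [ogd_k]. replace (S i + k)%nat with (S (i + k)) by lia.
    assert (Hx := base_pred_in B x0 y (S i) (S (i + k)) HB H0).
    unfold base_pred at 1 2 in Hx. replace (S (i + k) - S i)%nat with k in Hx by lia.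
    set (x := ogd_k B x0 y (S i) k) in *. set (yt := y (S (i + k))) in *.
    assert (Hyt : - G <= yt <= G) by (apply Hy; lia).
    assert (Hp := proj_dist_sq B (x - / (2 * INR (S k)) * (2 * (x - yt))) u Hu).
    set (x' := proj _ _) in *.
    assert (Hk0 := pos_INR k). rewrite S_INR in *. set (r := INR k) in *.
    assert (Hs : (yt - x) ^ 2 <= (G + B) ^ 2) by nra.
    (* As (y - x)^2 - (y - u)^2 = 2 (x - u) (x - y) - (x - u)^2, adding the loss difference leaves
       the old potential r (x - u)^2 and an error (y - x)^2 / (r + 1). *)
    assert (E : (r + 1) * (x - / (2 * (r + 1)) * (2 * (x - yt)) - u) ^ 2
                = (r + 1) * (x - u) ^ 2 - 2 * (x - u) * (x - yt) + (yt - x) ^ 2 * / (r + 1))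
      by (field; lra).
    assert (Hi : 0 < / (r + 1)) by (apply Rinv_0_lt_compat; lra).
    assert ((yt - x) ^ 2 * / (r + 1) <= (G + B) ^ 2 * / (r + 1))
      by (apply Rmult_le_compat_r; lra).
    assert ((r + 1) * (x' - u) ^ 2
            <= (r + 1) * (x - / (2 * (r + 1)) * (2 * (x - yt)) - u) ^ 2)
      by (apply Rmult_le_compat_l; lra).
    lra.
Qed.

(** * Regret of the meta-algorithm *)

(* The function [b |-> (1 + a^2 - a b) exp ((b^2 - a^2) / 2)] has derivative
   [(b - a) (1 - a b)] times a positive factor, so its minimum on [[-1, 1]] is
   its value [1] at [b = a]. *)
Lemma gauss_tangent_unit (a b : R) :
  -1 <= a <= 1 -> -1 <= b <= 1 -> exp (- (b ^ 2 / 2)) <= exp (- (a ^ 2 / 2)) * (1 - a * (b - a)).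
Proof.
  intros Ha Hb.
  set (g := fun z => (1 + a ^ 2 - a * z) * exp ((z ^ 2 - a ^ 2) / 2)).
  set (g' := fun z => (z - a) * (1 - a * z) * exp ((z ^ 2 - a ^ 2) / 2)).
  assert (Hd : forall z, derivable_pt_lim g z (g' z)).
  { intros z.
    replace (g' z) with
      ((0 - a * 1) * exp ((z ^ 2 - a ^ 2) / 2)
       + (1 + a ^ 2 - a * z) * (exp ((z ^ 2 - a ^ 2) / 2) * ((INR 2 * z ^ 1 - 0) * / 2)))
      by (unfold g'; simpl; field).
    apply (derivable_pt_lim_mult (fun z => 1 + a ^ 2 - a * z) (fun z => exp ((z ^ 2 - a ^ 2) / 2))).
    - apply (derivable_pt_lim_minus (fun _ => 1 + a ^ 2) (fun z => a * z)).
      + apply derivable_pt_lim_const.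
      + apply (derivable_pt_lim_scal (fun z => z)). apply derivable_pt_lim_id.
    - apply (derivable_pt_lim_comp (fun z => (z ^ 2 - a ^ 2) / 2) exp).
      + rewrite Rmult_comm.
        apply derivable_pt_lim_ext with (fun z => / 2 * (z ^ 2 - a ^ 2)).
        { intros; unfold Rdiv; ring. }
        apply (derivable_pt_lim_scal (fun z => z ^ 2 - a ^ 2)).
        apply (derivable_pt_lim_minus (fun z => z ^ 2) (fun _ => a ^ 2)).
        * apply derivable_pt_lim_pow.
        * apply derivable_pt_lim_const.
      + apply derivable_pt_lim_exp. }
  assert (Hga : g a = 1).
  { unfold g. replace ((a ^ 2 - a ^ 2) / 2) with 0 by field. rewrite exp_0. ring. }
  assert (Hg : 1 <= g b).
  { destruct (Rtotal_order a b) as [Hab|[->|Hab]].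
    - destruct (MVT_cor2 g g' a b Hab) as [c [E Hc]]; [intros; apply Hd|].
      assert (He := exp_pos ((c ^ 2 - a ^ 2) / 2)).
      assert (0 <= g' c * (b - a)).
      { apply Rmult_le_pos; [|lra]. unfold g'. repeat apply Rmult_le_pos; nra. }
      lra.
    - lra.
    - destruct (MVT_cor2 g g' b a Hab) as [c [E Hc]]; [intros; apply Hd|].
      assert (He := exp_pos ((c ^ 2 - a ^ 2) / 2)).
      assert (0 <= - g' c * (a - b)).
      { apply Rmult_le_pos; [|lra]. unfold g'.
        replace (- ((c - a) * (1 - a * c) * exp ((c ^ 2 - a ^ 2) / 2)))
          with ((a - c) * (1 - a * c) * exp ((c ^ 2 - a ^ 2) / 2)) by ring.
        repeat apply Rmult_le_pos; nra. }
      lra. }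
  replace (exp (- (a ^ 2 / 2)) * (1 - a * (b - a))) with (exp (- (b ^ 2 / 2)) * g b).
  - assert (He := exp_pos (- (b ^ 2 / 2))). nra.
  - unfold g. replace (- (a ^ 2 / 2)) with (- (b ^ 2 / 2) + (b ^ 2 - a ^ 2) / 2) by field.
    rewrite exp_plus. ring.
Qed.

(** Tangent line at [p] of q -> exp (- q^2 / (2 r^2)), which is concave on [-r, r]. For r = G + B
    this is exp-concavity of the square loss at rate [zeta]. *)
Lemma gauss_tangent (r p q : R) :
  0 < r -> - r <= p <= r -> - r <= q <= r ->
  exp (- (1 / (2 * r ^ 2)) * q ^ 2)
  <= exp (- (1 / (2 * r ^ 2)) * p ^ 2) * (1 - p / r ^ 2 * (q - p)).
Proof.
  intros Hr Hp Hq.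
  assert (Hu : forall z, - r <= z <= r -> -1 <= z / r <= 1).
  { intros z Hz. split.
    - apply Rmult_le_reg_r with r; [lra|]. field_simplify; lra.
    - apply Rmult_le_reg_r with r; [lra|]. field_simplify; lra. }
  assert (H := gauss_tangent_unit (p / r) (q / r) (Hu p Hp) (Hu q Hq)).
  replace (- (1 / (2 * r ^ 2)) * q ^ 2) with (- ((q / r) ^ 2 / 2)) by (field; lra).
  replace (- (1 / (2 * r ^ 2)) * p ^ 2) with (- ((p / r) ^ 2 / 2)) by (field; lra).
  replace (p / r ^ 2 * (q - p)) with (p / r * (q / r - p / r)) by (field; lra).
  exact H.
Qed.

(** Jensen's inequality: the tangent bound taken at the mean residual is averaged, and its linear
    term cancels. *)
Lemma gauss_jensen (r z : R) (v x : nat -> R) (n : nat) :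
  0 < r -> (forall j, (1 <= j <= n)%nat -> 0 <= v j) -> sum_to v n = 1 ->
  (forall j, (1 <= j <= n)%nat -> - r <= z - x j <= r) ->
  sum_to (fun j => v j * exp (- (1 / (2 * r ^ 2)) * (z - x j) ^ 2)) n
  <= exp (- (1 / (2 * r ^ 2)) * (z - sum_to (fun j => v j * x j) n) ^ 2).
Proof.
  intros Hr Hv Hs Hx. set (xb := sum_to (fun j => v j * x j) n).
  assert (E : sum_to (fun j => v j * (z - x j)) n = z - xb).
  { rewrite (sum_to_ext _ (fun j => z * v j - v j * x j)) by (intros; ring).
    rewrite sum_to_minus, sum_to_scal, Hs. unfold xb. ring. }
  assert (Hb : - r <= z - xb <= r).
  { rewrite <- E. split.
    - replace (- r) with (- r * sum_to v n) by (rewrite Hs; ring). rewrite <- sum_to_scal.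
      apply sum_to_le. intros t Ht. assert (H1 := Hv t Ht). assert (H2 := Hx t Ht). nra.
    - replace r with (r * sum_to v n) by (rewrite Hs; ring). rewrite <- sum_to_scal.
      apply sum_to_le. intros t Ht. assert (H1 := Hv t Ht). assert (H2 := Hx t Ht). nra. }
  set (p := z - xb) in *. set (e := exp (- (1 / (2 * r ^ 2)) * p ^ 2)).
  apply Rle_trans with
    (sum_to (fun j => e * (1 + p / r ^ 2 * p) * v j - e * (p / r ^ 2) * (v j * (z - x j))) n).
  - apply sum_to_le. intros t Ht.
    assert (H1 := gauss_tangent r p (z - x t) Hr Hb (Hx t Ht)). fold e in H1.
    assert (H2 := Rmult_le_compat_l (v t) _ _ (Hv t Ht) H1). lra.
  - rewrite sum_to_minus, !sum_to_scal, E, Hs. fold p. apply Req_le. ring.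
Qed.

(** Positivity justifies taking logarithms of weights and normalizers; total mass 1 is needed for
    Jensen. [flh_vk k] is the vector at time k+1, hence the range up to [S k]. *)
Lemma flh_weights (B G x0 : R) (y : nat -> R) (k : nat) :
  (forall i, (1 <= i <= S k)%nat -> 0 < flh_vk B G x0 y k i) /\
  sum_to (flh_vk B G x0 y k) (S k) = 1.
Proof.
  induction k as [|k [IHp IHs]].
  - split; [|simpl; lra]. intros i Hi. replace i with 1%nat by lia. simpl. lra.
  - cbn [flh_vk]. unfold flh_step.
    set (e := fun i => exp (- zeta B G * (y (S k) - base_pred B x0 y i (S k)) ^ 2)).
    set (v := flh_vk B G x0 y k) in *.
    set (Z := sum_to (fun j => v j * e j) (S k)).
    assert (Hve : forall j, (1 <= j <= S k)%nat -> 0 < v j * e j).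
    { intros j Hj. apply Rmult_lt_0_compat; [apply IHp, Hj|apply exp_pos]. }
    assert (HZ : 0 < Z).
    { apply Rlt_le_trans with (v 1%nat * e 1%nat); [apply Hve; lia|].
      apply (sum_to_ge_term (fun j => v j * e j)); [|lia].
      intros t Ht. apply Rlt_le, Hve, Ht. }
    assert (Hk1 : 1 < INR (S (S k))) by (rewrite !S_INR; assert (H := pos_INR k); lra).
    assert (Hinv : 0 < / INR (S (S k)) < 1).
    { split; [apply Rinv_0_lt_compat; lra|]. rewrite <- Rinv_1. apply Rinv_lt_contravar; lra. }
    (* All old learners share one normalizing factor, so they keep total mass 1 - 1/(k+2) and the
       newcomer supplies the rest. *)
    assert (Hold : forall i, (1 <= i <= S k)%nat ->
      (if (i =? S (S k))%nat then / INR (S (S k))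
       else if ((1 <=? i)%nat && (i <=? S k)%nat)%bool
            then (1 - / INR (S (S k))) * (v i * e i / Z) else 0)
      = (1 - / INR (S (S k))) / Z * (v i * e i)).
    { intros i Hi.
      replace (i =? S (S k))%nat with false by (symmetry; apply Nat.eqb_neq; lia).
      replace (1 <=? i)%nat with true by (symmetry; apply Nat.leb_le; lia).
      replace (i <=? S k)%nat with true by (symmetry; apply Nat.leb_le; lia).
      simpl andb. cbv iota. field. lra. }
    split.
    + intros i Hi. destruct (Nat.eq_dec i (S (S k))) as [->|Hne].
      * rewrite Nat.eqb_refl. lra.
      * rewrite Hold by lia. apply Rmult_lt_0_compat; [|apply Hve; lia].
        apply Rdiv_lt_0_compat; lra.
    + rewrite sum_to_S.
      rewrite (sum_to_ext _ (fun i => (1 - / INR (S (S k))) / Z * (v i * e i))) by exact Hold.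
      rewrite sum_to_scal. fold Z.
      rewrite Nat.eqb_refl. field. lra.
Qed.

(* Telescoping potential: by [gauss_jensen] the loss of the meta-algorithm is at
   most the log of the normalizer, which the weight update exposes as a ratio of
   successive weights of the learner [S i]. *)
Lemma flh_regret_potential (B G x0 : R) (y : nat -> R) (n i k : nat) :
  0 < B -> B <= G -> - B <= x0 <= B ->
  (forall t, (1 <= t <= n)%nat -> - G <= y t <= G) -> (i + k <= n)%nat ->
  let f := fun t => (y t - flh_ogd_pred B G x0 y t) ^ 2
                    - (y t - base_pred B x0 y (S i) t) ^ 2 in
  zeta B G * (sum_to f (i + k) - sum_to f i)
  <= ln (INR (S (i + k))) + ln (flh_vk B G x0 y (i + k) (S i)).
Proof.
  intros HB HG H0 Hy Hk f. induction k as [|k IH].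
  - rewrite Nat.add_0_r.
    (* Learner [S i] enters with weight 1/(i+1), so the right side starts at 0. *)
    assert (E : flh_vk B G x0 y i (S i) = / INR (S i)).
    { destruct i as [|i]; [simpl; lra|]. cbn [flh_vk]. unfold flh_step.
      rewrite Nat.eqb_refl. reflexivity. }
    rewrite E, ln_Rinv by (apply lt_0_INR; lia). lra.
  - specialize (IH ltac:(lia)).
    rewrite Nat.add_succ_r. set (m := (i + k)%nat) in *.
    cbn [sum_to flh_vk]. unfold flh_step.
    replace (S i =? S (S m))%nat with false by (symmetry; apply Nat.eqb_neq; lia).
    replace (1 <=? S i)%nat with true by (symmetry; apply Nat.leb_le; lia).
    replace (S i <=? S m)%nat with true by (symmetry; apply Nat.leb_le; lia).
    cbn [andb].
    destruct (flh_weights B G x0 y m) as [Hp Hs].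
    set (v := flh_vk B G x0 y m) in *.
    set (x := fun j => base_pred B x0 y j (S m)).
    assert (Hym := Hy (S m) ltac:(lia)).
    assert (HJ := gauss_jensen (G + B) (y (S m)) v x (S m) ltac:(lra)
                    ltac:(intros; apply Rlt_le, Hp; assumption) Hs).
    assert (Hx : forall j, (1 <= j <= S m)%nat -> - (G + B) <= y (S m) - x j <= G + B).
    { intros j _. assert (H := base_pred_in B x0 y j (S m) ltac:(lra) H0). unfold x. lra. }
    specialize (HJ Hx).
    replace (sum_to (fun j => v j * x j) (S m)) with (flh_ogd_pred B G x0 y (S m)) in HJ
      by (unfold flh_ogd_pred, flh_v; replace (S m - 1)%nat with m by lia; reflexivity).
    fold (zeta B G) in HJ. unfold f at 2. fold (x (S i)).
    change (sum_to (fun j => v j * exp (- zeta B G * (y (S m) - base_pred B x0 y j (S m)) ^ 2)) (S m))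
      with (sum_to (fun j => v j * exp (- zeta B G * (y (S m) - x j) ^ 2)) (S m)).
    set (Z := sum_to (fun j => v j * exp (- zeta B G * (y (S m) - x j) ^ 2)) (S m)) in *.
    assert (Hv := Hp (S i) ltac:(lia)).
    assert (Ht : forall j, (1 <= j <= S m)%nat ->
              0 < v j * exp (- zeta B G * (y (S m) - x j) ^ 2)).
    { intros j Hj. apply Rmult_lt_0_compat; [apply Hp, Hj|apply exp_pos]. }
    assert (HZ : 0 < Z).
    { apply Rlt_le_trans with (v 1%nat * exp (- zeta B G * (y (S m) - x 1%nat) ^ 2)).
      - apply Ht; lia.
      - apply (sum_to_ge_term (fun j => v j * exp (- zeta B G * (y (S m) - x j) ^ 2))); [|lia].
        intros t Htt. apply Rlt_le, Ht, Htt. }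
    assert (HlZ : ln Z <= - zeta B G * (y (S m) - flh_ogd_pred B G x0 y (S m)) ^ 2).
    { rewrite <- ln_exp. apply ln_monotone; assumption. }
    assert (Hm : 0 < INR (S m)) by (apply lt_0_INR; lia).
    assert (Hm' : 0 < INR (S (S m))) by (apply lt_0_INR; lia).
    (* The mass given to the newcomer costs a factor (m+1)/(m+2), which the growth of the first
       logarithm absorbs exactly. *)
    replace (1 - / INR (S (S m))) with (INR (S m) * / INR (S (S m)))
      by (rewrite (S_INR (S m)) in *; field; lra).
    assert (Hi' : 0 < / INR (S (S m))) by (apply Rinv_0_lt_compat; lra).
    assert (HZ' : 0 < / Z) by (apply Rinv_0_lt_compat; lra).
    assert (He := exp_pos (- zeta B G * (y (S m) - x (S i)) ^ 2)).
    unfold Rdiv.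
    rewrite !ln_mult, ln_exp, !ln_Rinv; try assumption;
      repeat apply Rmult_lt_0_compat; try assumption.
    lra.
Qed.

(** The learner started at the left end of the interval is the intermediary: regret of the
    meta-algorithm against it costs at most 4 (G+B)^2 ln n, and its own regret against [u] at most 2
    (G+B)^2 ln n. *)
Lemma flh_interval_regret (B G x0 u : R) (y : nat -> R) (n i s : nat) :
  0 < B -> B <= G -> - B <= x0 <= B -> - B <= u <= B -> (3 <= n)%nat ->
  (forall t, (1 <= t <= n)%nat -> - G <= y t <= G) -> (i < s <= n)%nat ->
  let f := fun t => (y t - flh_ogd_pred B G x0 y t) ^ 2 - (y t - u) ^ 2 in
  sum_to f s - sum_to f i <= 6 * (G + B) ^ 2 * ln (INR n).
Proof.
  intros HB HG H0 Hu Hn Hy Hs f.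
  set (k := (s - i)%nat).
  assert (Es : s = (i + k)%nat) by (unfold k; lia).
  assert (H1 := flh_regret_potential B G x0 y n i k HB HG H0 Hy ltac:(lia)).
  assert (H2 := ogd_regret B G x0 u y n i k ltac:(lra) H0 Hu Hy ltac:(lia)).
  cbv zeta in H1, H2. rewrite <- Es in H1, H2.
  set (f1 := fun t => (y t - flh_ogd_pred B G x0 y t) ^ 2
                      - (y t - base_pred B x0 y (S i) t) ^ 2) in *.
  set (f2 := fun t => (y t - base_pred B x0 y (S i) t) ^ 2 - (y t - u) ^ 2) in *.
  assert (E : forall m, sum_to f m = sum_to f1 m + sum_to f2 m).
  { intros m. rewrite <- sum_to_plus. apply sum_to_ext. intros; unfold f, f1, f2. ring. }
  rewrite !E.
  assert (Hn3 := le_INR _ _ Hn). replace (INR 3) with 3 in Hn3 by (simpl; ring).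
  assert (Hl := ln_ge_1 n Hn).
  assert (Hk0 : 0 <= INR k * (ogd_k B x0 y (S i) k - u) ^ 2).
  { apply Rmult_le_pos; [apply pos_INR|apply pow2_ge_0]. }
  assert (Hh : sum_to (fun t => / INR t) k <= 1 + ln (INR n)).
  { apply Rle_trans with (1 + ln (INR k)); [apply sum_inv_le_ln; unfold k; lia|].
    apply Rplus_le_compat_l, ln_monotone; [apply lt_0_INR; unfold k; lia|].
    apply le_INR. unfold k; lia. }
  destruct (flh_weights B G x0 y s) as [Hp Hsum].
  assert (Hv := Hp (S i) ltac:(lia)).
  assert (Hv1 : flh_vk B G x0 y s (S i) <= 1).
  { rewrite <- Hsum. apply sum_to_ge_term; [|lia]. intros t Ht. apply Rlt_le, Hp, Ht. }
  assert (Hlv : ln (flh_vk B G x0 y s (S i)) <= 0) by (rewrite <- ln_1; apply ln_monotone; assumption).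
  (* Here s + 1 <= n + 1 <= n^2. *)
  assert (Hls : ln (INR (S s)) <= 2 * ln (INR n)).
  { replace (2 * ln (INR n)) with (ln (INR n * INR n)) by (rewrite ln_mult by lra; ring).
    apply ln_monotone; [apply lt_0_INR; lia|]. rewrite S_INR.
    assert (H := le_INR _ _ (proj2 Hs)). nra. }
  assert (HR : 0 < (G + B) ^ 2) by nra.
  assert (H1' : sum_to f1 s - sum_to f1 i <= 2 * (G + B) ^ 2 * (2 * ln (INR n))).
  { replace (sum_to f1 s - sum_to f1 i)
      with (2 * (G + B) ^ 2 * (zeta B G * (sum_to f1 s - sum_to f1 i)))
      by (unfold zeta; field; lra).
    apply Rmult_le_compat_l; lra. }
  assert (H2' : (G + B) ^ 2 * sum_to (fun t => / INR t) k <= (G + B) ^ 2 * (1 + ln (INR n)))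
    by (apply Rmult_le_compat_l; lra).
  nra.
Qed.

(** * Comparators with few jumps *)

(** Real-valued, so that it can be averaged over the shifts. *)
Definition jumps (u : nat -> R) : nat -> R :=
  sum_to (fun t => if (2 <=? t)%nat then if Req_dec_T (u t) (u (t - 1)%nat) then 0 else 1 else 0).

Lemma piecewise_constant_regret (B K : R) (x y u : nat -> R) (n : nat) :
  (forall i s c, (i < s <= n)%nat -> - B <= c <= B ->
     let f := fun t => (y t - x t) ^ 2 - (y t - c) ^ 2 in sum_to f s - sum_to f i <= K) ->
  (forall t, (1 <= t <= n)%nat -> - B <= u t <= B) -> (1 <= n)%nat ->
  sum_to (fun t => (y t - x t) ^ 2 - (y t - u t) ^ 2) n <= K * (1 + jumps u n).
Proof.
  intros HK Hu Hn. set (f := fun t => (y t - x t) ^ 2 - (y t - u t) ^ 2).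
  assert (Hpiece : forall i s, (i < s <= n)%nat -> (forall t, (i < t <= s)%nat -> u t = u s) ->
            sum_to f s - sum_to f i <= K).
  { intros i s His Hc.
    rewrite (sum_to_ext_range f (fun t => (y t - x t) ^ 2 - (y t - u s) ^ 2)).
    - apply HK; [exact His|apply Hu; lia].
    - lia.
    - intros t Ht. unfold f. rewrite (Hc t Ht). reflexivity. }
  (* Invariant: [i] ends the last completed piece. Each jump pays for the piece it closes; the
     current piece [(i, s]] is still unpaid and accounts for the extra 1. *)
  assert (Hmain : forall s, (1 <= s <= n)%nat -> exists i, (i < s)%nat /\
            (forall t, (i < t <= s)%nat -> u t = u s) /\ sum_to f i <= K * jumps u s).
  { induction s as [|s IH]; intros Hs; [lia|].
    destruct (Nat.eq_dec s 0) as [->|Hs0].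
    - exists 0%nat. split; [lia|]. split; [|unfold jumps; simpl; lra].
      intros t Ht. f_equal. lia.
    - destruct (IH ltac:(lia)) as [i [Hi [Hc Hsum]]].
      unfold jumps. cbn [sum_to]. fold (jumps u s).
      replace (2 <=? S s)%nat with true by (symmetry; apply Nat.leb_le; lia).
      replace (S s - 1)%nat with s by lia.
      destruct (Req_dec_T (u (S s)) (u s)) as [E|E].
      + exists i. split; [lia|]. split; [|lra].
        intros t Ht. destruct (Nat.eq_dec t (S s)) as [->|Hne]; [reflexivity|].
        rewrite E. apply Hc. lia.
      + exists s. split; [lia|]. split.
        * intros t Ht. f_equal. lia.
        * assert (H := Hpiece i s ltac:(lia) Hc). lra. }
  destruct (Hmain n ltac:(lia)) as [i [Hi [Hc Hsum]]].
  assert (H := Hpiece i n ltac:(lia) Hc). lra.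
Qed.

(** * Rounding with a common shift *)

(** [up x] is the integer with x < up x <= x + 1; [Z.to_nat] sends negative values to 0, so this is
    the floor only for x >= 0. *)
Definition nat_floor (x : R) : nat := Z.to_nat (up x - 1).

Lemma nat_floor_bounds (x : R) : 0 <= x -> INR (nat_floor x) <= x < INR (nat_floor x) + 1.
Proof.
  intros Hx. destruct (archimed x) as [H1 H2]. unfold nat_floor.
  assert (Hz : (0 <= up x - 1)%Z).
  { assert (0 < up x)%Z; [|lia]. apply lt_IZR. lra. }
  rewrite INR_IZR_INZ, Z2Nat.id by exact Hz. rewrite minus_IZR. lra.
Qed.

(** Two windows of length [m] starting at a and a+1 differ only in their end terms; [k - 1] appears
    because [sum_to] starts at 1. *)
Lemma sum_to_shift (g : nat -> R) (a m : nat) :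
  sum_to (fun k => g (S a + (k - 1))%nat) m + g a
  = sum_to (fun k => g (a + (k - 1))%nat) m + g (a + m)%nat.
Proof.
  induction m as [|m IH]; [simpl; rewrite Nat.add_0_r; ring|].
  cbn [sum_to]. replace (S m - 1)%nat with m by lia.
  replace (S a + m)%nat with (a + S m)%nat by lia. lra.
Qed.

(* Hermite's identity. *)
Lemma sum_div_shift (a m : nat) :
  (1 <= m)%nat -> sum_to (fun k => INR ((a + (k - 1)) / m)) m = INR a.
Proof.
  intros Hm. induction a as [|a IH].
  - rewrite (sum_to_ext _ (fun _ => 0)).
    + rewrite sum_to_const. simpl; ring.
    + intros t Ht. rewrite Nat.div_small by lia. reflexivity.
  - assert (H := sum_to_shift (fun b => INR (b / m)) a m). cbv beta in H.
    rewrite IH in H. replace (a + m)%nat with (a + 1 * m)%nat in H by lia.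
    rewrite Nat.div_add in H by lia. rewrite plus_INR in H. change (INR 1) with 1 in H.
    rewrite S_INR. lra.
Qed.

(** Division is monotone, so all differences have one sign and the absolute value leaves the sum.
    This is where sharing one shift matters. *)
Lemma sum_div_shift_dist (a b m : nat) :
  (1 <= m)%nat ->
  sum_to (fun k => Rabs (INR ((a + (k - 1)) / m) - INR ((b + (k - 1)) / m))) m
  = Rabs (INR a - INR b).
Proof.
  intros Hm. destruct (Nat.le_ge_cases a b) as [Hab|Hab].
  - rewrite (sum_to_ext _ (fun k => INR ((b + (k - 1)) / m) - INR ((a + (k - 1)) / m))).
    + rewrite sum_to_minus, !sum_div_shift by exact Hm.
      assert (H := le_INR _ _ Hab). rewrite Rabs_left1; lra.
    + intros t _.
      assert (H : INR ((a + (t - 1)) / m) <= INR ((b + (t - 1)) / m))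
        by (apply le_INR, Nat.Div0.div_le_mono; lia).
      rewrite Rabs_left1; lra.
  - rewrite (sum_to_ext _ (fun k => INR ((a + (k - 1)) / m) - INR ((b + (k - 1)) / m))).
    + rewrite sum_to_minus, !sum_div_shift by exact Hm.
      assert (H := le_INR _ _ Hab). rewrite Rabs_right; lra.
    + intros t _.
      assert (H : INR ((b + (t - 1)) / m) <= INR ((a + (t - 1)) / m))
        by (apply le_INR, Nat.Div0.div_le_mono; lia).
      rewrite Rabs_right; lra.
Qed.

Lemma Rabs_INR_diff_ge_1 (a b : nat) : a <> b -> 1 <= Rabs (INR a - INR b).
Proof.
  intros H. destruct (Nat.lt_ge_cases a b) as [Hab|Hab].
  - assert (H1 := le_INR (S a) b ltac:(lia)). rewrite S_INR in H1. rewrite Rabs_left1; lra.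
  - assert (H1 := le_INR (S b) a ltac:(lia)). rewrite S_INR in H1. rewrite Rabs_right; lra.
Qed.

Section Rounding.

Variables (B d : R) (m N : nat).
Hypothesis Hd : 0 < d.
Hypothesis Hm : (1 <= m)%nat.
(** The coarse grid of width [d] ends exactly at [B]; this keeps rounded values inside [-B, B]. *)
Hypothesis HN : d * INR N = 2 * B.

(** Index of [w] on the fine grid of width d/m. With z = (w + B) / d, floor (z + (k-1)/m) is the
    integer quotient of floor (m z) + k - 1 by m, so shift number [k] is U = (k-1)/m. *)
Definition grid_index (w : R) : nat := nat_floor (INR m * ((w + B) / d)).

Definition shifted_round (k : nat) (w : R) : R :=
  - B + d * INR ((grid_index w + (k - 1)) / m).

Let Hm0 : 1 <= INR m.
Proof. exact (le_INR _ _ Hm). Qed.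

Lemma grid_index_bounds (w : R) :
  - B <= w -> INR (grid_index w) * d <= INR m * (w + B) < (INR (grid_index w) + 1) * d.
Proof.
  intros Hw. assert (H : 0 <= INR m * ((w + B) / d)).
  { apply Rmult_le_pos; [lra|]. unfold Rdiv. apply Rmult_le_pos; [lra|].
    apply Rlt_le, Rinv_0_lt_compat, Hd. }
  apply nat_floor_bounds in H. fold (grid_index w) in H.
  replace (INR m * (w + B)) with (INR m * ((w + B) / d) * d) by (field; lra).
  split; [apply Rmult_le_compat_r|apply Rmult_lt_compat_r]; lra.
Qed.

Lemma shifted_round_in (k : nat) (w : R) :
  (1 <= k <= m)%nat -> - B <= w <= B -> - B <= shifted_round k w <= B.
Proof.
  intros Hk Hw. unfold shifted_round.
  destruct (grid_index_bounds w ltac:(lra)) as [Ha _].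
  set (a := grid_index w) in *.
  assert (HaN : (a <= m * N)%nat).
  { apply INR_le. rewrite mult_INR. apply Rmult_le_reg_r with d; [exact Hd|]. nra. }
  assert (Hq : ((a + (k - 1)) / m <= N)%nat).
  { apply Nat.lt_succ_r. apply Nat.Div0.div_lt_upper_bound. nia. }
  apply le_INR in Hq. assert (Hq0 := pos_INR ((a + (k - 1)) / m)). nra.
Qed.

Lemma shifted_round_dist (k : nat) (w : R) :
  (1 <= k <= m)%nat -> - B <= w -> (w - shifted_round k w) ^ 2 <= d ^ 2.
Proof.
  intros Hk Hw. unfold shifted_round.
  destruct (grid_index_bounds w Hw) as [Ha1 Ha2].
  set (a := grid_index w) in *.
  assert (H1 := Nat.Div0.mul_div_le (a + (k - 1)) m).
  assert (H2 := Nat.mul_succ_div_gt (a + (k - 1)) m ltac:(lia)).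
  set (q := ((a + (k - 1)) / m)%nat) in *.
  (* In [H2'], strictness of the division bound gives the + 1 that pays for the fine-grid error of
     [w]. *)
  assert (H1' : (m * q + 1 <= a + m)%nat) by lia.
  assert (H2' : (a + 1 <= m * q + m)%nat) by nia.
  apply le_INR in H1', H2'. rewrite !plus_INR, mult_INR in H1', H2'. simpl (INR 1) in *.
  set (r := INR m) in *.
  assert (L : - d <= w - (- B + d * INR q)).
  { apply Rmult_le_reg_l with r; [lra|]. nra. }
  assert (U : w - (- B + d * INR q) <= d).
  { apply Rmult_le_reg_l with r; [lra|]. nra. }
  nra.
Qed.

(** By Hermite's identity the coarse errors average out; only the fine-grid remainder m (w + B) - a
    d, with a the index of [w], survives. *)
Lemma shifted_round_bias (w : R) :
  - B <= w -> 0 <= sum_to (fun k => w - shifted_round k w) m <= d.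
Proof.
  intros Hw. unfold shifted_round.
  rewrite (sum_to_ext _ (fun k => (w + B) - d * INR ((grid_index w + (k - 1)) / m)))
    by (intros; ring).
  rewrite sum_to_minus, sum_to_const, sum_to_scal, sum_div_shift by exact Hm.
  assert (H := grid_index_bounds w Hw). lra.
Qed.

(** A jump moves the integer quotient by at least 1, and the total movement over all shifts is the
    distance of the fine indices, which exceeds m |w - w'| / d by at most 1. *)
Lemma shifted_round_jump (w w' : R) :
  - B <= w -> - B <= w' ->
  sum_to (fun k => if Req_dec_T (shifted_round k w) (shifted_round k w') then 0 else 1) m
  <= INR m * (Rabs (w - w') / d) + 1.
Proof.
  intros Hw Hw'.
  apply Rle_trans with (Rabs (INR (grid_index w) - INR (grid_index w'))).
  - rewrite <- (sum_div_shift_dist _ _ m Hm). apply sum_to_le. intros k _.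
    destruct Req_dec_T as [E|E]; [apply Rabs_pos|].
    apply Rabs_INR_diff_ge_1. intros Hq. apply E. unfold shifted_round. rewrite Hq. reflexivity.
  - apply Rmult_le_reg_r with d; [exact Hd|].
    replace ((INR m * (Rabs (w - w') / d) + 1) * d) with (INR m * Rabs (w - w') + d)
      by (field; lra).
    assert (H := grid_index_bounds w Hw). assert (H' := grid_index_bounds w' Hw').
    assert (E1 := Rle_abs (w - w')). assert (E2 := Rle_abs (- (w - w'))). rewrite Rabs_Ropp in E2.
    unfold Rabs at 1. destruct Rcase_abs; nra.
Qed.

End Rounding.

(** * Regret against comparators of bounded variation *)

(** Averages over [n] shifts. In the factor 2 + C/d, one unit is the first piece and the other comes
    from the + 1 in [shifted_round_jump], summed over [n] times and divided by [n]. *)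
Lemma rounding_regret (B G C K d : R) (x y w : nat -> R) (n N : nat) :
  0 < B -> B <= G -> 0 < d -> d * INR N = 2 * B -> 0 <= K -> (1 <= n)%nat ->
  (forall i s c, (i < s <= n)%nat -> - B <= c <= B ->
     let f := fun t => (y t - x t) ^ 2 - (y t - c) ^ 2 in sum_to f s - sum_to f i <= K) ->
  (forall t, (1 <= t <= n)%nat -> - G <= y t <= G) -> in_TV B C n w ->
  sum_to (fun t => (y t - x t) ^ 2 - (y t - w t) ^ 2) n
  <= K * (2 + C / d) + INR n * d ^ 2 + 2 * (G + B) * d.
Proof.
  intros HB HG Hd HN HK Hn Hreg Hy [HTV Hw].
  assert (Hw' : forall t, (1 <= t <= n)%nat -> - B <= w t <= B).
  { intros t Ht. assert (H := Hw t Ht). unfold Rabs in H. destruct Rcase_abs; lra. }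
  set (u := fun k t => shifted_round B d n k (w t)).
  set (reg := sum_to (fun t => (y t - x t) ^ 2 - (y t - w t) ^ 2) n).
  assert (Hr : 1 <= INR n) by exact (le_INR _ _ Hn).
  (* For each shift, (y - u)^2 - (y - w)^2 = 2 (y - w) (w - u) + (w - u)^2. *)
  assert (Hk : forall k, (1 <= k <= n)%nat ->
    reg <= K * (1 + jumps (u k) n)
           + sum_to (fun t => 2 * (y t - w t) * (w t - u k t) + d ^ 2) n).
  { intros k Hk.
    assert (H := piecewise_constant_regret B K x y (u k) n Hreg
      ltac:(intros t Ht; apply (shifted_round_in B d n N Hd Hn HN); auto) Hn).
    apply Rle_trans with
      (sum_to (fun t => (y t - x t) ^ 2 - (y t - u k t) ^ 2) n
       + sum_to (fun t => (y t - u k t) ^ 2 - (y t - w t) ^ 2) n).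
    { right. unfold reg. rewrite <- sum_to_plus. apply sum_to_ext. intros; ring. }
    apply Rplus_le_compat; [exact H|]. apply sum_to_le. intros t Ht.
    assert (H1 := shifted_round_dist B d n Hd Hn k (w t) Hk ltac:(apply Hw', Ht)).
    fold (u k t) in H1. lra. }
  assert (Hsum : INR n * reg <= sum_to (fun k => K * (1 + jumps (u k) n)
      + sum_to (fun t => 2 * (y t - w t) * (w t - u k t) + d ^ 2) n) n).
  { rewrite <- sum_to_const. apply sum_to_le. exact Hk. }
  rewrite sum_to_plus, sum_to_scal, sum_to_plus, sum_to_const in Hsum.
  assert (Hjump : sum_to (fun k => jumps (u k) n) n <= INR n * (C / d) + INR n).
  { unfold jumps. rewrite sum_to_exchange.
    apply Rle_trans with (sum_to (fun t => INR n / d *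
      (if (2 <=? t)%nat then Rabs (w t - w (t - 1)%nat) else 0) + 1) n).
    - apply sum_to_le. intros t Ht. destruct (Nat.leb_spec 2 t) as [H2|H2].
      + apply Rle_trans with (INR n * (Rabs (w t - w (t - 1)%nat) / d) + 1).
        * apply (shifted_round_jump B d n Hd Hn); apply Hw'; lia.
        * right. field. lra.
      + rewrite sum_to_const. lra.
    - rewrite sum_to_plus, sum_to_scal, sum_to_const.
      replace (INR n * (C / d)) with (INR n / d * C) by (field; lra).
      rewrite Rmult_1_r. apply Rplus_le_compat_r, Rmult_le_compat_l; [|exact HTV].
      apply Rlt_le, Rdiv_lt_0_compat; lra. }
  (* For fixed [t] the factor 2 (y - w) does not depend on the shift, so only the total bias, at
     most [d], meets it. *)
  assert (Hcross : sum_to (fun k => sum_to (fun t => 2 * (y t - w t) * (w t - u k t) + d ^ 2) n) n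
    <= INR n * (2 * (G + B) * d + INR n * d ^ 2)).
  { rewrite sum_to_exchange, <- sum_to_const. apply sum_to_le. intros t Ht.
    rewrite sum_to_plus, sum_to_scal, sum_to_const. apply Rplus_le_compat_r.
    assert (H1 := shifted_round_bias B d n Hd Hn (w t) ltac:(apply Hw', Ht)).
    assert (H2 := Hw' t Ht). assert (H3 := Hy t Ht).
    change (2 * (y t - w t) * sum_to (fun k => w t - shifted_round B d n k (w t)) n
            <= 2 * (G + B) * d).
    set (s := sum_to _ n) in *. nra. }
  assert (HKj := Rmult_le_compat_l K _ _ HK Hjump).
  apply Rmult_le_reg_l with (INR n); [lra|]. nra.
Qed.

(** Cubing removes the fractional exponents, leaving a polynomial inequality for tuning the grid
    width. *)
Lemma rpow_cube_le (n : nat) (C Q : R) :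
  (1 <= n)%nat -> 0 <= C -> 0 <= Q ->
  rpow (INR n) (1 / 3) * rpow C (2 / 3) <= Q -> INR n * C ^ 2 <= Q ^ 3.
Proof.
  intros Hn HC HQ H. assert (Hn0 : 0 < INR n) by (apply lt_0_INR; lia).
  unfold rpow in H. destruct (Rle_dec (INR n) 0) as [|_]; [lra|].
  destruct (Rle_dec C 0) as [HC0|HC0].
  - replace C with 0 by lra. assert (0 <= Q ^ 3) by (apply pow_le; exact HQ). lra.
  - assert (E : INR n * C ^ 2 = (Rpower (INR n) (1 / 3) * Rpower C (2 / 3)) ^ 3).
    { rewrite Rpow_mult_distr, <- !Rpower_pow, !Rpower_mult by (try apply exp_pos; lra).
      replace (1 / 3 * INR 3) with 1 by (simpl; field).
      replace (2 / 3 * INR 3) with (INR 2) by (simpl; field).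
      rewrite Rpower_1 by exact Hn0. reflexivity. }
    rewrite E. apply pow_incr. split; [|exact H].
    apply Rlt_le, Rmult_lt_0_compat; apply exp_pos.
Qed.

(** Covers the regime where the target rate is at least [n]: predictions are convex combinations of
    points of [-B, B]. *)
Lemma flh_trivial_regret (B G x0 : R) (y w : nat -> R) (n : nat) :
  0 < B -> B <= G -> - B <= x0 <= B ->
  (forall t, (1 <= t <= n)%nat -> - G <= y t <= G) ->
  sum_to (fun t => (y t - flh_ogd_pred B G x0 y t) ^ 2 - (y t - w t) ^ 2) n
  <= INR n * (G + B) ^ 2.
Proof.
  intros HB HG H0 Hy. rewrite <- sum_to_const. apply sum_to_le. intros t Ht.
  assert (Hyt := Hy t Ht).
  assert (Hx : - B <= flh_ogd_pred B G x0 y t <= B).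
  { unfold flh_ogd_pred, flh_v. destruct t as [|t]; [lia|].
    replace (S t - 1)%nat with t by lia.
    destruct (flh_weights B G x0 y t) as [Hp Hs].
    assert (Hb := fun j => base_pred_in B x0 y j (S t) ltac:(lra) H0).
    split.
    - replace (- B) with (- B * sum_to (flh_vk B G x0 y t) (S t)) by (rewrite Hs; ring).
      rewrite <- sum_to_scal. apply sum_to_le. intros j Hj.
      assert (H1 := Hp j Hj). assert (H2 := Hb j). nra.
    - apply Rle_trans with (B * sum_to (flh_vk B G x0 y t) (S t)); [|rewrite Hs; lra].
      rewrite <- sum_to_scal. apply sum_to_le. intros j Hj.
      assert (H1 := Hp j Hj). assert (H2 := Hb j). nra. }
  assert (H := pow2_ge_0 (y t - w t)). nra.
Qed.

Theorem theorem1 :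
  exists p : R, 0 <= p /\
  forall B G : R, 1 <= B -> B <= G ->
  exists c : R, 0 < c /\
  forall x0 : R, - B <= x0 <= B ->
  forall n : nat, (3 <= n)%nat ->
  forall y : nat -> R, (forall t : nat, (1 <= t <= n)%nat -> - G <= y t <= G) ->
  forall Cn : R, 0 <= Cn ->
  forall w : nat -> R, in_TV B Cn n w ->
    sum_to (fun t => (y t - flh_ogd_pred B G x0 y t) ^ 2 - (y t - w t) ^ 2) n
    <= c * Rpower (ln (INR n)) p
         * Rmax (rpow (INR n) (1/3) * rpow Cn (2/3)) 1.
Proof.
  exists 1. split; [lra|]. intros B G HB HG.
  set (K := 6 * (G + B) ^ 2).
  assert (HK : 24 <= K) by (unfold K; nra).
  (* The three terms pay for K L (2 + C/d) <= 4 K L Q, for n d^2 <= Q, and for the bias 2 (G + B)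
     d. *)
  exists (4 * K + 1 + 4 * (G + B) * B). split; [nra|].
  intros x0 H0 n Hn y Hy C HC w Hw.
  assert (Hl := ln_ge_1 n Hn). rewrite Rpower_1 by lra.
  set (Q := Rmax _ 1).
  assert (HQ1 : 1 <= Q) by apply Rmax_r.
  assert (HQ3 : INR n * C ^ 2 <= Q ^ 3).
  { apply rpow_cube_le; [lia|exact HC|lra|apply Rmax_l]. }
  assert (Hn3 := le_INR _ _ Hn). replace (INR 3) with 3 in Hn3 by (simpl; ring).
  set (L := ln (INR n)) in *. set (r := INR n) in *.
  assert (HQL : Q <= L * Q) by nra.
  assert (HGB : 0 <= (G + B) * B) by nra.
  destruct (Rle_lt_dec r Q) as [Hbig|Hsmall].
  - apply Rle_trans with (r * (G + B) ^ 2).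
    { apply flh_trivial_regret; assumption || lra. }
    unfold K in *. assert (0 <= (G + B) ^ 2) by nra.
    assert (r * (G + B) ^ 2 <= (L * Q) * (G + B) ^ 2) by (apply Rmult_le_compat_r; lra).
    assert (0 <= L * Q) by lra.
    assert (0 <= (23 * (G + B) ^ 2 + 1 + 4 * ((G + B) * B)) * (L * Q))
      by (apply Rmult_le_pos; lra).
    lra.
  - (* The grid width [d] is [2 B / N], between [e / 2] and [e = sqrt (Q / n)]. *)
    set (e := sqrt (Q / r)).
    assert (Hq : 0 < Q / r < 1).
    { split; [apply Rdiv_lt_0_compat; lra|].
      apply Rmult_lt_reg_r with r; [lra|]. field_simplify; lra. }
    assert (He : e * e = Q / r) by (apply sqrt_sqrt; lra).
    assert (He0 : 0 < e) by (apply sqrt_lt_R0; lra).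
    assert (He1 : e < 1) by nra.
    assert (Hre : r * e ^ 2 = Q) by (replace (e ^ 2) with (e * e) by ring; rewrite He; field; lra).
    (* This is n C^2 <= Q^3 rewritten with n e^2 = Q. When Q = n^(1/3) C^(2/3), [e] is
       (C/n)^(1/3). *)
    assert (HCe : C <= Q * e).
    { apply Rsqr_incr_0_var; [|nra]. unfold Rsqr.
      apply Rmult_le_reg_l with r; [lra|].
      replace (r * (Q * e * (Q * e))) with (Q ^ 2 * (r * e ^ 2)) by ring.
      rewrite Hre. lra. }
    set (N := S (nat_floor (2 * B / e))).
    assert (Hz : 0 <= 2 * B / e) by (apply Rlt_le, Rdiv_lt_0_compat; lra).
    assert (HN := nat_floor_bounds _ Hz).
    assert (HNr : 2 * B / e < INR N <= 2 * B / e + 1) by (unfold N; rewrite S_INR; lra).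
    assert (HeN : 2 * B < INR N * e <= 2 * B + e).
    { replace (2 * B) with (2 * B / e * e) by (field; lra).
      split; nra. }
    assert (HN0 : 0 < INR N) by (apply lt_0_INR; unfold N; lia).
    set (d := 2 * B / INR N).
    assert (HdN : d * INR N = 2 * B) by (unfold d; field; lra).
    assert (Hd0 : 0 < d) by (unfold d; apply Rdiv_lt_0_compat; lra).
    assert (Hd1 : d <= e) by (apply Rmult_le_reg_r with (INR N); lra).
    (* Since e < 1 <= B, N e <= 2 B + e <= 4 B. *)
    assert (Hd2 : e / 2 <= d) by (apply Rmult_le_reg_r with (INR N); lra).
    assert (HCd : C / d <= 2 * Q).
    { apply Rmult_le_reg_r with d; [exact Hd0|].
      replace (C / d * d) with C by (field; lra). nra. }
    assert (Hrd : r * d ^ 2 <= Q) by (rewrite <- Hre; apply Rmult_le_compat_l; [lra|nra]).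
    assert (H := rounding_regret B G C (K * L) d (flh_ogd_pred B G x0 y) y w n N
              ltac:(lra) HG Hd0 HdN ltac:(nra) ltac:(lia)
              ltac:(intros; apply flh_interval_regret; assumption || lra) Hy Hw).
    fold r in H.
    assert (HKL : K * L * (2 + C / d) <= K * L * (4 * Q)) by (apply Rmult_le_compat_l; nra).
    assert (2 * (G + B) * d <= 4 * ((G + B) * B) * (L * Q)).
    { apply Rle_trans with (2 * ((G + B) * B)); nra. }
    nra.
Qed.
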